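(* If $f\in\mathcal{F}$ is proper, then $\partial f$ is maximal monotone and belongs to $\mathcal{T}$. Conversely, if $T\in\mathcal{T}$ is maximal monotone, then there exists a proper, lower semi-continuous, convex function $f:\mathbb{R}\to(-\infty,+\infty]$ such that $T=\partial f$ and, moreover, any such function belongs to $\mathcal{F}$.
   Context: **Functions.** For $f:\mathbb{R}\to[-\infty,+\infty]$, the effective domain is $\operatorname{dom} f=\{x\in\mathbb{R}: |f(x)|<+\infty\}$. $f$ is proper if it is not everywhere infinite and nowhere equal to $-\infty$; it is closed if its epigraph is a closed set (equivalently, $f$ is lower semi-continuous). $f$ is strictly convex if $f(\lambda x+(1-\lambda)y)<\lambda f(x)+(1-\lambda)f(y)$ for all $x\neq y$ in $\operatorname{dom} f$ and $\lambda\in(0,1)$ (on an interval: for $x\ne y$ in that interval). The subdifferential of a convex $f$ is the set-valued map with $\partial f(\overline{x})=\{\phi\in\mathbb{R}: \phi\,(x-\overline{x})\le f(x)-f(\overline{x})\ \text{for all } x\in\mathbb{R}\}$ if $\overline{x}\in\operatorname{dom} f$, and $\partial f(\overline{x})=\emptyset$ otherwise. **The class $\mathcal{F}$.** For a finite set $A=\{a_i\}_{i=0}^m$ with $a_0=-\infty<a_1<\dots<a_{m-1}<a_m=+\infty$, a function $f:\mathbb{R}\to(-\infty,+\infty]$ belongs to $\mathcal{F}(A)$ if: (a) $f$ is closed and convex; (b) $f$ is continuous on its effective domain; and (c) the restriction of $f$ to each interval $(a_i,a_{i+1})$ is either (i) affine, (ii) strictly convex and differentiable, or (iii) identically equal to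 $+\infty$. The class $\mathcal{F}$ is the union of $\mathcal{F}(A)$ over all such finite sets $A$. **Monotone operators.** Let $T:\mathbb{R}\rightrightarrows\mathbb{R}$ be a set-valued map with $\operatorname{dom} T=\{x: Tx\neq\emptyset\}$ and $\operatorname{gph} T=\{(x,y): y\in Tx\}$. $T$ is monotone if $(x-y)(x^+-y^+)\ge 0$ for all $(x,x^+),(y,y^+)\in\operatorname{gph} T$; it is strictly monotone if the inequality is strict whenever $x\neq y$; it is maximal monotone if it is monotone and no monotone operator has a graph properly containing $\operatorname{gph} T$. A maximal monotone extension of $T$ is a maximal monotone operator $\widetilde{T}$ with $\operatorname{gph} T\subseteq\operatorname{gph}\widetilde{T}$. **The class $\mathcal{T}$.** For a finite set $B=\{b_i\}_{i=0}^l$ with $b_0=-\infty<b_1<\dots<b_{l-1}<b_l=+\infty$, a set-valued operator $T:\mathbb{R}\rightrightarrows\mathbb{R}$ belongs to $\mathcal{T}(B)$ if there exists a maximal monotone extension $\widetilde{T}$ of $T$ such that the restriction of $\widetilde{T}$ to each interval $(b_i,b_{i+1})$ is either (i) single-valued and constant; (ii) single-valued, continuous and strictly monotone; or (iii) identically equal to the empty set. The class $\mathcal{T}$ is the union of $\mathcal{T}(B)$ over all such finite sets $B$. *)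

(* Defs.v *)
From mathcomp Require Import all_boot all_order all_algebra.
From mathcomp Require Import all_classical all_reals all_analysis.

Set Implicit Arguments.
Unset Strict Implicit.
Unset Printing Implicit Defensive.
Import Order.TTheory GRing.Theory Num.Theory.
Import numFieldNormedType.Exports.

Local Open Scope classical_set_scope.
Local Open Scope ring_scope.

Section Definitions.
Variable R : realType.
Implicit Types (f : R -> \bar R) (T S : R -> set R) (I D : set R).

Definition effective_domain f : set R := [set x | f x \is a fin_num].

Definition proper_function f : Prop :=
  (exists x, f x \is a fin_num) /\ (forall x, f x != -oo%E).

Definition epigraph f : set (R * R) := [set p | (f p.1 <= p.2%:E)%E].

Definition closed_function f : Prop := closed (epigraph f).

(* Convexity of the epigraph makes sense for all extended-real-valued f,
   without a convention for (+oo) + (-oo); when f never takes the value -oo it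
   is the inequality f (t x + (1 - t) y) <= t f x + (1 - t) f y. *)
Definition convex_efun f : Prop := convex_set (epigraph f).

Definition strictly_convex_on D f : Prop :=
  forall x y t, D x -> D y -> x != y -> 0 < t < 1 ->
    (f (t * x + (1 - t) * y)%R < t%:E * f x + (1 - t)%:E * f y)%E.

Definition affine_on D f : Prop :=
  exists a b, forall x, D x -> f x = (a * x + b)%:E.

(* Only used for open D: f is then finite around each point of D, where it
   agrees with the real-valued function fine \o f. *)
Definition differentiable_on D f : Prop :=
  forall x, D x -> f x \is a fin_num /\ derivable (fine \o f) x 1.

Definition subdifferential f : R -> set R := fun xbar =>
  [set phi | f xbar \is a fin_num /\
    forall x, ((phi * (x - xbar))%:E <= f x - f xbar)%E].

(* A finite set {-oo = a_0 < a_1 < ... < a_m = +oo} is given by the increasing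
   sequence of its elements; the defaults +oo and -oo exclude the empty one. *)
Definition breakpoints (A : seq (\bar R)) : Prop :=
  [/\ head +oo%E A = -oo%E, last -oo%E A = +oo%E & sorted <%O A].

Definition gap (A : seq (\bar R)) (i : nat) : set R :=
  [set x | (nth -oo A i < x%:E < nth -oo A i.+1)%E].

Definition class_F_of (A : seq (\bar R)) f : Prop :=
  [/\ forall x, f x != -oo%E,
      closed_function f /\ convex_efun f,
      {within effective_domain f, continuous f} &
      forall i, (i.+1 < size A)%N ->
        [\/ affine_on (gap A i) f,
            strictly_convex_on (gap A i) f /\ differentiable_on (gap A i) f |
            forall x, gap A i x -> f x = +oo%E]].

Definition class_F f : Prop :=
  exists A : seq (\bar R), breakpoints A /\ class_F_of A f.

Definition graph_of T : set (R * R) := [set p | T p.1 p.2].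

Definition monotone_op T : Prop :=
  forall x y x' y', T x x' -> T y y' -> 0 <= (x - y) * (x' - y').

Definition strictly_monotone_op T : Prop :=
  monotone_op T /\
  forall x y x' y', T x x' -> T y y' -> x != y -> 0 < (x - y) * (x' - y').

Definition maximal_monotone T : Prop :=
  monotone_op T /\
  ~ (exists S, monotone_op S /\ graph_of T `<` graph_of S).

Definition maximal_monotone_extension T S : Prop :=
  maximal_monotone S /\ graph_of T `<=` graph_of S.

Definition restrict_op I T : R -> set R := fun x => [set y | I x /\ T x y].

Definition class_T_of (B : seq (\bar R)) T : Prop :=
  exists2 S, maximal_monotone_extension T S &
    forall i, (i.+1 < size B)%N ->
      [\/ exists c, forall x, gap B i x -> S x = [set c],
          (exists2 g : R -> R, (forall x, gap B i x -> S x = [set g x]) &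
                               {within gap B i, continuous g})
          /\ strictly_monotone_op (restrict_op (gap B i) S) |
          forall x, gap B i x -> S x = set0].

Definition class_T T : Prop :=
  exists B : seq (\bar R), breakpoints B /\ class_T_of B T.

End Definitions.

(* Main.v *)
(* Maximality of the subdifferential of f is Minty's argument: for every a the
   function z |-> f z + (z - a)^2 / 2 has a minimizer z, and a - z is then a
   subgradient of f at z; a pair (x, q) monotonically related to the whole graph
   is compared with the z obtained for a = x + q, which forces x = z.
   Conversely, a monotone operator on the line is cyclically monotone, because
   finitely many points of its graph form a chain for the product order and
   hence carry subgradients of a common piecewise affine function; Rockafellar's
   supremum over chains then integrates it. The pieces correspond with A = B:
   affine to constant and +oo to empty, since convex functions have subgradients
   at the interior points of their domains, and strictly convex differentiable
   to continuous strictly monotone: for a single-valued selection g of the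
   subdifferential on an open set, f is differentiable iff g is continuous. *)
Require Import Defs.
From mathcomp Require Import all_boot all_order all_algebra.
From mathcomp Require Import all_classical all_reals all_analysis.
From mathcomp Require Import ring lra.
Import numFieldNormedType.Exports.

Set Implicit Arguments.
Unset Strict Implicit.
Unset Printing Implicit Defensive.
Import Order.TTheory GRing.Theory Num.Theory.

Local Open Scope classical_set_scope.
Local Open Scope ring_scope.

(** * Subgradients of convex functions *)

Lemma fin_num_le_EFin (R : realType) (y : \bar R) (r : R) :
  y != -oo%E -> (y <= r%:E)%E -> exists c, y = c%:E.
Proof. by case: y => [c|//|//] _ _; exists c. Qed.

Lemma fin_numEx (R : realType) (y : \bar R) :
  y \is a fin_num -> exists c, y = c%:E.
Proof. by case: y => // c _; exists c. Qed.

(** Quantifying over points (y, r) of the epigraph keeps the inequality in real arithmetic: it is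
    vacuous where [f y] is +oo, and both sides fail where [f y] is -oo. *)
Lemma subdifferentialP (R : realType) (f : R -> \bar R) (x c phi : R) :
  f x = c%:E ->
  subdifferential f x phi <->
  forall y r, (f y <= r%:E)%E -> c + phi * (y - x) <= r.
Proof.
move=> fx; rewrite /subdifferential /= fx; split.
  move=> [_ h] y r; have := h y; case: (f y) => [v| |] //=.
    by rewrite -EFinB !lee_fin; lra.
move=> h; split=> // y; have := h y; case: (f y) => [v| |] /= hy.
- by rewrite -EFinB lee_fin; have := hy v (lexx _); lra.
- by rewrite addye// leey.
- have := hy (c + phi * (y - x) - 1); rewrite leNye => /(_ isT).
  by rewrite leNgt => /negP[]; lra.
Qed.

Lemma convex_efun_le (R : realType) (f : R -> \bar R) (x y r s t : R) :
  convex_efun f -> 0 <= t -> t <= 1 -> (f x <= r%:E)%E -> (f y <= s%:E)%E ->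
  (f (t * x + (1 - t) * y)%R <= (t * r + (1 - t) * s)%R%:E)%E.
Proof.
move=> cf t0 t1 fx fy.
have t01 : Itv.spec (@Itv.num_sem R) (Itv.Real `[0%Z, 1%Z]) t.
  by rewrite /Itv.spec /= /Itv.num_sem /= in_itv /= t0 t1 num_real.
have := cf (x, r) (y, s) (Itv.mk t01).
by rewrite !inE /epigraph /= => /(_ fx fy).
Qed.

Lemma convex_efun_chord (R : realType) (f : R -> \bar R) (x y z r s : R) :
  convex_efun f -> x < z -> z < y -> (f x <= r%:E)%E -> (f y <= s%:E)%E ->
  (f z <= (((y - z) * r + (z - x) * s) / (y - x))%R%:E)%E.
Proof.
move=> cf xz zy fx fy.
have yx : 0 < y - x by lra.
have t0 : 0 <= (y - z) / (y - x) by rewrite divr_ge0//; lra.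
have t1 : (y - z) / (y - x) <= 1 by rewrite ler_pdivrMr//; lra.
have := convex_efun_le cf t0 t1 fx fy.
have -> : (y - z) / (y - x) * x + (1 - (y - z) / (y - x)) * y = z.
  by field; lra.
suff -> : (y - z) / (y - x) * r + (1 - (y - z) / (y - x)) * s =
  ((y - z) * r + (z - x) * s) / (y - x) by [].
by field; lra.
Qed.

(** The supremum of the chord slopes to the left of z is a subgradient, since by convexity every
    left slope is at most every right slope. The point x makes the set of slopes nonempty and y
    bounds it. *)
Lemma interior_subgradient (R : realType) (f : R -> \bar R) (x y z r s : R) :
  convex_efun f -> (forall u, f u != -oo%E) -> x < z -> z < y ->
  (f x <= r%:E)%E -> (f y <= s%:E)%E -> exists phi, subdifferential f z phi.
Proof.
move=> cf fN xz zy fx fy.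
have [c fz] := fin_num_le_EFin (fN z) (convex_efun_chord cf xz zy fx fy).
pose E := [set p | exists u v, [/\ u < z, (f u <= v%:E)%E & p = (c - v) / (z - u)]].
have E0 : E !=set0 by exists ((c - r) / (z - x)), x, r.
have ubE w q : z < w -> (f w <= q%:E)%E -> ubound E ((q - c) / (w - z)).
  move=> zw fw p [u [v [uz fu ->]]].
  have := convex_efun_chord cf uz zw fu fw.
  rewrite fz lee_fin ler_pdivlMr ?ler_pdivrMr; [|lra..].
  rewrite mulrAC ler_pdivlMr; [|lra].
  by nra.
have supE : has_sup E by split=> //; eexists; exact: (ubE y s).
exists (sup E); apply/(subdifferentialP _ fz) => w q fw.
case: (ltgtP w z) => [wz|zw|wz].
- have : (c - q) / (z - w) <= sup E by apply: sup_upper_bound => //; exists w, q.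
  by rewrite ler_pdivrMr; [lra|lra].
- have : sup E <= (q - c) / (w - z) by apply: ge_sup => //; exact: ubE.
  by rewrite ler_pdivlMr; [lra|lra].
- by move: fw; rewrite wz fz lee_fin; lra.
Qed.

Lemma singleton_domain_subgradient (R : realType) (f : R -> \bar R) (x c phi : R) :
  f x = c%:E -> (forall y, y != x -> f y = +oo%E) -> subdifferential f x phi.
Proof.
move=> fx h; apply/(subdifferentialP _ fx) => y r.
have [->|/h ->//] := eqVneq y x.
by rewrite fx lee_fin; lra.
Qed.

Lemma two_points_or_singleton (R : realType) (f : R -> \bar R) (x : R) :
  (forall u, f u != -oo%E) ->
  (exists2 y, y != x & f y \is a fin_num) \/ (forall y, y != x -> f y = +oo%E).
Proof.
move=> fN; have [h|h] := pselect (exists2 y, y != x & f y \is a fin_num).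
  by left.
right=> y yx; case: (f y) (fN y) (fun k => h (ex_intro2 _ _ y yx k)) => //=.
Qed.

Lemma exists_subgradient (R : realType) (f : R -> \bar R) :
  proper_function f -> convex_efun f -> exists x phi, subdifferential f x phi.
Proof.
move=> [[x /fin_numEx[c fx]] fN] cf.
have [[y yx /fin_numEx[d fy]]|h] := two_points_or_singleton x fN.
  exists ((x + y) / 2).
  have fx' : (f x <= c%:E)%E by rewrite fx.
  have fy' : (f y <= d%:E)%E by rewrite fy.
  case: (ltgtP x y) => [xy|xy|xy]; last by rewrite xy eqxx in yx.
    by apply: (interior_subgradient cf fN _ _ fx' fy'); lra.
  by apply: (interior_subgradient cf fN _ _ fy' fx'); lra.
by exists x, 0; exact: singleton_domain_subgradient fx h.
Qed.

Lemma subdifferential_monotone (R : realType) (f : R -> \bar R) :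
  monotone_op (subdifferential f).
Proof.
move=> x y p q hx hy.
have [/fin_numEx[c fx] _] := hx; have [/fin_numEx[d fy] _] := hy.
move: hx hy => /(subdifferentialP _ fx)/(_ y d) + /(subdifferentialP _ fy)/(_ x c).
rewrite fx fy !lee_fin !lexx => /(_ isT) ? /(_ isT) ?.
by nra.
Qed.

(** * Maximality of the subdifferential *)

Lemma ge0_of_small_perturbation (R : realType) (D w : R) :
  0 <= w -> (forall t, 0 < t -> t <= 1 -> 0 <= D + t * w) -> 0 <= D.
Proof.
move=> w0 h; rewrite leNgt; apply/negP => D0.
have wD : 0 < w - 2 * D by lra.
(* For t = -D / (w - 2D), the quantity D + t w equals 2 t D, which is negative. *)
have t0 : 0 < - D / (w - 2 * D) by rewrite divr_gt0//; lra.
have t1 : - D / (w - 2 * D) <= 1 by rewrite ler_pdivrMr//; lra.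
have := h _ t0 t1; rewrite leNgt => /negP[].
have : - D / (w - 2 * D) * (w - 2 * D) = - D by field; lra.
by nra.
Qed.

(** The minimization runs over the epigraph, where the objective [h] is continuous, so only
    closedness of the epigraph is needed. The affine minorant given by one subgradient makes the
    sublevel set [E] bounded, hence compact. *)
Lemma resolvent_exists (R : realType) (f : R -> \bar R) (a : R) :
  proper_function f -> closed_function f -> convex_efun f ->
  exists z, subdifferential f z (a - z).
Proof.
move=> pf clf cf; have fN := pf.2.
have [x0 [p dfp]] := exists_subgradient pf cf.
have [/fin_numEx[c fx0] _] := dfp.
move/(subdifferentialP _ fx0) : dfp => dfp.
pose h (q : R * R) : R := q.2 + (q.1 - a) ^+ 2 / 2.
pose M := c + (x0 - a) ^+ 2 / 2.
pose E := epigraph f `&` [set q | h q <= M].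
have hc : continuous h.
  move=> q; apply: cvgD; first exact: cvg_snd.
  apply: cvgM; last exact: cvg_cst.
  apply: (@cvg_comp _ _ _ (fun q : R * R => q.1 - a) (fun r : R => r ^+ 2)).
    by apply: cvgB; [exact: cvg_fst|exact: cvg_cst].
  exact: exprn_continuous.
have clE : closed E.
  apply: closedI => //.
  rewrite (_ : [set q | h q <= M] = h @^-1` [set r | r <= M])//.
  by apply: preimage_closed => [q _|]; [exact: hc|exact: closed_le].
have E0 : E (x0, c).
  by split; rewrite /epigraph /h /M /= ?fx0.
(* With u = z - x0, the minorant r >= c + p u and [h (z, r) <= M] give u^2 / 2 + (p + x0 - a) u <=
   0, so |u| <= K. *)
pose K := 2 * `|p + (x0 - a)|.
have Ebox : E `<=` `[x0 - K, x0 + K] `*` `[c - `|p| * K, M].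
  move=> [z r] [/dfp/= zr]; rewrite /h /M /= => rM.
  have uK : `|z - x0| <= K.
    rewrite /K; have [->|u0] := eqVneq (z - x0) 0.
      by rewrite normr0 mulr_ge0.
    have up : 0 < `|z - x0| by rewrite normr_gt0.
    have q0 : (z - x0) ^+ 2 <= - (2 * (z - x0) * (p + (x0 - a))) by nra.
    rewrite -(ler_pM2l up) -expr2 real_normK ?num_real//.
    apply: (le_trans q0); apply: (le_trans (ler_norm _)).
    by rewrite normrN !normrM gtr0_norm// mulrCA mulrA.
  have puK : `|p * (z - x0)| <= `|p| * K by rewrite normrM ler_wpM2l.
  move: uK puK; rewrite !ler_norml => /andP[? ?] /andP[? ?].
  have := sqr_ge0 (z - a).
  by split; rewrite /= in_itv /= ?/M; apply/andP; split; lra.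
have cE : compact E.
  apply: subclosed_compact clE _ Ebox.
  by apply: compact_setX; exact: segment_compact.
have [[z r] /set_mem[/= fzr zrM] zmin] := compact_EVT_min (ex_intro _ _ E0) cE
  (continuous_subspaceT hc).
have [v fz] := fin_num_le_EFin (fN z) fzr.
have vr : v <= r by move: fzr; rewrite /epigraph /= fz lee_fin.
(* Epigraph points outside [E] have [h] above [M], so the minimum over [E] is a minimum over the
   whole epigraph. *)
have hmin y s : (f y <= s%:E)%E -> v + (z - a) ^+ 2 / 2 <= s + (y - a) ^+ 2 / 2.
  move=> fy; apply: le_trans (_ : h (z, r) <= _); first by rewrite /h/=; lra.
  have [hM|/ltW Mh] := leP (h (y, s)) M; last exact: le_trans Mh.
  by apply: (zmin (y, s)); apply/mem_set.
(* Compare z with z + t (y - z), divide by t and let t tend to 0. *)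
exists z; apply/(subdifferentialP _ fz) => y s fy.
rewrite -subr_ge0.
apply: (@ge0_of_small_perturbation _ _ ((y - z) ^+ 2 / 2)).
  by rewrite divr_ge0 ?sqr_ge0.
move=> t t0 t1.
have fz' : (f z <= v%:E)%E by rewrite fz.
have := hmin _ _ (convex_efun_le cf (ltW t0) t1 fy fz').
by rewrite -(pmulr_rge0 _ t0); nra.
Qed.

Lemma subdifferential_maximal (R : realType) (f : R -> \bar R) :
  proper_function f -> closed_function f -> convex_efun f ->
  maximal_monotone (subdifferential f).
Proof.
move=> pf clf cf; split; first exact: subdifferential_monotone.
move=> [S [monoS [sub nsub]]]; apply: nsub => -[x q] /= Sxq.
have [z dfz] := resolvent_exists (x + q) pf clf cf.
have := monoS _ _ _ _ Sxq (sub (z, _) dfz).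
have -> : (x - z) * (q - (x + q - z)) = - (x - z) ^+ 2 by ring.
rewrite oppr_ge0 => h.
have : (x - z) ^+ 2 == 0 by rewrite eq_le h sqr_ge0.
rewrite sqrf_eq0 subr_eq0 => /eqP xz.
by move: dfz; rewrite -xz addrC addKr.
Qed.

(** * Subgradients on open sets *)

Lemma open_ballP (R : realType) (I : set R) (x : R) :
  open I -> I x -> exists2 d, 0 < d & forall y, `|y - x| < d -> I y.
Proof.
move=> oI Ix; have /nbhs_ballP[d d0 dI] := open_nbhs_nbhs (conj oI Ix).
by exists d => // y yx; apply: dI; rewrite /ball/= distrC.
Qed.

Lemma gap_open (R : realType) (A : seq (\bar R)) (i : nat) : open (gap A i).
Proof.
have -> : gap A i = [set x | (nth -oo A i < x%:E)%E] `&`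
                    [set x | (x%:E < nth -oo A i.+1)%E].
  by apply/seteqP; split=> x /=; [move=> /andP[]|move=> [? ?]; apply/andP].
apply: openI.
- case: (nth _ _ i) => [a| |].
  + exact: open_gt.
  + have -> : [set x : R | (+oo < x%:E)%E] = set0 by apply/seteqP; split.
    exact: open0.
  + have -> : [set x : R | (-oo < x%:E)%E] = setT.
      by apply/seteqP; split=> x //= _; rewrite ltNyr.
    exact: openT.
- case: (nth _ _ i.+1) => [a| |].
  + exact: open_lt.
  + have -> : [set x : R | (x%:E < +oo)%E] = setT.
      by apply/seteqP; split=> x //= _; rewrite ltry.
    exact: openT.
  + have -> : [set x : R | (x%:E < -oo)%E] = set0 by apply/seteqP; split.
    exact: open0.
Qed.

Lemma gap_between (R : realType) (A : seq (\bar R)) (i : nat) (x y z : R) :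
  gap A i x -> gap A i y -> x <= z -> z <= y -> gap A i z.
Proof.
move=> /andP[ax _] /andP[_ yb] xz zy; apply/andP; split.
  by apply: lt_le_trans ax _; rewrite lee_fin.
by apply: le_lt_trans yb; rewrite lee_fin.
Qed.

(** The division-free form of the derivative, valid also at h = 0, combines directly with
    subgradient inequalities. *)
Lemma derivable_expansion (R : realType) (F : R -> R) (x : R) :
  derivable F x 1 -> forall e, 0 < e ->
  exists2 d, 0 < d & forall h, `|h| < d ->
    `|F (x + h) - F x - F^`()%classic x * h| <= e * `|h|.
Proof.
move=> dF e e0; have := dF => /(@cvgrPdist_lt _ R^o)/(_ e e0).
rewrite -/(derive F x 1) -derive1E => /nbhs_ballP[d d0 hd].
exists d => // h hd0; have [->|h0] := eqVneq h 0.
  by rewrite addr0 mulr0 !subrr normr0 mulr0.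
have := hd h; rewrite /ball /= sub0r normrN => /(_ hd0 h0) /ltW.
rewrite /GRing.scale /= mulr1 [h + x]addrC => H.
have h1 : 0 < `|h| by rewrite normr_gt0.
rewrite -(ler_pM2r h1) -normrM in H.
apply: le_trans H; rewrite -[leLHS]normrN le_eqVlt; apply/orP; left.
by apply/eqP; congr (`|_|); field.
Qed.

Lemma derivable_of_expansion (R : realType) (F : R -> R) (x l : R) :
  (forall e, 0 < e -> exists2 d, 0 < d & forall h, `|h| < d ->
    `|F (x + h) - F x - l * h| <= e * `|h|) -> derivable F x 1.
Proof.
move=> hF; apply/cvg_ex; exists l; apply/(@cvgrPdist_le _ R^o) => e e0.
have [d d0 hd] := hF e e0.
apply/nbhs_ballP; exists d => // h; rewrite /ball /= sub0r normrN => hd0 h0.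
have h1 : 0 < `|h| by rewrite normr_gt0.
rewrite -(ler_pM2r h1) -normrM; apply: le_trans (hd _ hd0).
rewrite -[leRHS]normrN le_eqVlt; apply/orP; left.
by apply/eqP; congr (`|_|); rewrite /GRing.scale /= mulr1 [h + x]addrC; field.
Qed.

(** The expansions at h and at -h bound [phi] minus the derivative by e from both sides. *)
Lemma subgradient_eq_derive1 (R : realType) (F : R -> R) (x phi d : R) :
  derivable F x 1 -> 0 < d ->
  (forall h, `|h| < d -> phi * h <= F (x + h) - F x) -> phi = F^`()%classic x.
Proof.
move=> dF d0 hphi; set l := F^`()%classic x.
apply/eqP; rewrite -subr_eq0 -normr_le0; apply/ler_addgt0Pr => e e0; rewrite add0r.
have [d' d'0 hl] := derivable_expansion dF e0.
pose h := Num.min d d' / 2.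
have m0 : 0 < Num.min d d' by rewrite lt_min d0.
have h0 : 0 < h by rewrite divr_gt0.
have hm : h < Num.min d d' by rewrite /h; lra.
move: hm; rewrite lt_min => /andP[hd hd'].
have nh : `|h| = h by rewrite gtr0_norm.
have nNh : `|- h| = h by rewrite normrN.
have := hphi h; rewrite nh => /(_ hd) p1.
have := hphi (- h); rewrite nNh => /(_ hd) p2.
have := hl h; rewrite nh => /(_ hd'); rewrite ler_norml -/l => /andP[_ p3].
have := hl (- h); rewrite nNh => /(_ hd'); rewrite ler_norml -/l => /andP[_ p4].
by rewrite ler_norml -(ler_pM2r h0) -[(_ <= e)](ler_pM2r h0); apply/andP; split; lra.
Qed.

(** For z near x, [g z] lies between the slopes of the chords from z to x - h and to x + h. At z = x
    these slopes are within e / 2 of [g x], and they depend continuously on z. *)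
Lemma subgradient_continuous (R : realType) (I : set R) (F g : R -> R) :
  open I -> {in I &, forall x y, F x + g x * (y - x) <= F y} ->
  {in I, forall x, derivable F x 1} -> {in I, continuous g}.
Proof.
move=> oI hg dF x Ix; have /set_mem Ix' := Ix.
have [d0 d00 hd0] := open_ballP oI Ix'.
have gE y : I y -> g y = F^`()%classic y.
  move=> Iy; have [d dp hd] := open_ballP oI Iy.
  apply: (@subgradient_eq_derive1 _ F y _ d (dF _ (mem_set Iy)) dp) => h hh.
  have Iyh : I (y + h) by apply: hd; rewrite addrC addKr.
  have := hg _ _ (mem_set Iy) (mem_set Iyh).
  by rewrite [y + h - y]addrAC subrr add0r; lra.
have cF : {for x, continuous F}.
  by apply: differentiable_continuous; apply/derivable1_diffP; exact: dF.
apply/cvgrPdist_lt => e e0.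
have e20 : 0 < e / 2 by lra.
have [d1 d10 hd1] := derivable_expansion (dF x Ix) e20.
pose h := Num.min d0 d1 / 2.
have m0 : 0 < Num.min d0 d1 by rewrite lt_min d00.
have h0 : 0 < h by rewrite divr_gt0.
have : h < Num.min d0 d1 by rewrite /h; lra.
rewrite lt_min => /andP[hd hd'].
have nh : `|h| = h by rewrite gtr0_norm.
have nNh : `|- h| = h by rewrite normrN.
have := hd1 h; rewrite nh => /(_ hd'); rewrite ler_norml -gE// => /andP[_ p1].
have := hd1 (- h); rewrite nNh => /(_ hd'); rewrite ler_norml -gE// => /andP[_ p2].
have Ir : I (x + h) by apply: hd0; rewrite addrC addKr nh.
have Il : I (x - h) by apply: hd0; rewrite addrC addKr nNh.
(* At z = x both this function and the next are at most -(e / 2) h, so they stay negative nearby;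
   negativity says that the chord slopes lie below [g x + e] and above [g x - e] respectively. *)
have cr : {for x, continuous (fun z => F (x + h) - F z - (g x + e) * (x + h - z))}.
  apply: cvgB; first by apply: cvgB; [exact: cvg_cst|exact: cF].
  by apply: cvgM; [exact: cvg_cst|apply: cvgB; [exact: cvg_cst|exact: cvg_id]].
have cl : {for x, continuous (fun z => F (x - h) - F z - (g x - e) * (x - h - z))}.
  apply: cvgB; first by apply: cvgB; [exact: cvg_cst|exact: cF].
  by apply: cvgM; [exact: cvg_cst|apply: cvgB; [exact: cvg_cst|exact: cvg_id]].
have nr : \forall z \near x, F (x + h) - F z - (g x + e) * (x + h - z) < 0.
  by apply: (cvgr_lt _ cr); nra.
have nl : \forall z \near x, F (x - h) - F z - (g x - e) * (x - h - z) < 0.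
  by apply: (cvgr_lt _ cl); nra.
have nI : \forall z \near x, I z by exact: open_nbhs_nbhs (conj oI Ix').
near=> z.
have Iz : I z by near: z.
have zx : `|x - z| < h by near: z; apply/nbhs_ballP; exists h.
have zr : F (x + h) - F z - (g x + e) * (x + h - z) < 0 by near: z.
have zl : F (x - h) - F z - (g x - e) * (x - h - z) < 0 by near: z.
have := hg _ _ (mem_set Iz) (mem_set Ir).
have := hg _ _ (mem_set Iz) (mem_set Il).
move: zx; rewrite !ltr_norml => /andP[zx1 zx2] q1 q2.
by apply/andP; split; nra.
Unshelve. all: by end_near. Qed.

(** The subgradient inequalities at x and at x + h place the expansion error between 0 and (g (x +
    h) - g x) h. *)
Lemma continuous_subgradient_derivable (R : realType) (I : set R) (F g : R -> R) :
  open I -> {in I &, forall x y, F x + g x * (y - x) <= F y} ->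
  {within I, continuous g} -> {in I, forall x, derivable F x 1}.
Proof.
move=> oI hg cg x Ix; have /set_mem Ix' := Ix.
apply: (@derivable_of_expansion _ _ _ (g x)) => e e0.
have [d0 d00 hd0] := open_ballP oI Ix'.
have := cg; rewrite continuous_open_subspace// => /(_ x Ix).
move=> /cvgrPdist_le/(_ e e0)/nbhs_ballP[d1 d10 hd1].
exists (Num.min d0 d1); first by rewrite lt_min d00.
move=> h; rewrite lt_min => /andP[hh0 hh1].
have Ih : I (x + h) by apply: hd0; rewrite addrC addKr.
have := hd1 (x + h); rewrite /ball /= opprD addrA subrr sub0r normrN => /(_ hh1) gh.
have := hg _ _ Ix (mem_set Ih); rewrite [x + h - x]addrAC subrr add0r => q1.
have := hg _ _ (mem_set Ih) Ix; rewrite opprD addrA subrr sub0r => q2.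
rewrite ger0_norm; last by lra.
apply: (@le_trans _ _ ((g (x + h) - g x) * h)); first by lra.
by apply: le_trans (ler_norm _) _; rewrite normrM distrC ler_wpM2r.
Qed.

Lemma subdifferential_fine (R : realType) (f : R -> \bar R) (x y phi : R) :
  subdifferential f x phi -> f y \is a fin_num ->
  fine (f x) + phi * (y - x) <= fine (f y).
Proof.
move=> dfx /fin_numEx[d fy]; have [/fin_numEx[c fx] _] := dfx.
move: dfx => /(subdifferentialP _ fx)/(_ y d).
by rewrite fx fy /= lexx => /(_ isT).
Qed.

Lemma open_subgradient (R : realType) (f : R -> \bar R) (I : set R) (x : R) :
  convex_efun f -> (forall u, f u != -oo%E) -> open I ->
  (forall y, I y -> f y \is a fin_num) -> I x -> exists phi, subdifferential f x phi.
Proof.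
move=> cf fN oI fI Ix; have [d d0 hd] := open_ballP oI Ix.
have Il : I (x - d / 2).
  by apply: hd; rewrite addrAC subrr add0r normrN gtr0_norm//; lra.
have Ir : I (x + d / 2).
  by apply: hd; rewrite addrAC subrr add0r gtr0_norm//; lra.
have [[r fl] [s fr]] := (fin_numEx (fI _ Il), fin_numEx (fI _ Ir)).
apply: (@interior_subgradient _ f (x - d / 2) (x + d / 2) x r s) => //;
  by rewrite ?fl ?fr //; lra.
Qed.

(** * From the pieces of a function to the pieces of its subdifferential *)

Lemma subdifferential_affine (R : realType) (f : R -> \bar R) (I : set R) (a b : R) :
  convex_efun f -> (forall u, f u != -oo%E) -> open I ->
  (forall x, I x -> f x = (a * x + b)%:E) ->
  forall x, I x -> subdifferential f x = [set a].
Proof.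
move=> cf fN oI fab x Ix.
have fin y : I y -> f y \is a fin_num by move=> /fab ->.
have sub phi : subdifferential f x phi -> phi = a.
  move=> dphi; have [d d0 hd] := open_ballP oI Ix.
  have Il : I (x - d / 2).
    by apply: hd; rewrite addrAC subrr add0r normrN gtr0_norm//; lra.
  have Ir : I (x + d / 2).
    by apply: hd; rewrite addrAC subrr add0r gtr0_norm//; lra.
  have := subdifferential_fine dphi (fin _ Il).
  have := subdifferential_fine dphi (fin _ Ir).
  by rewrite !fab//= => h1 h2; apply/eqP; rewrite eq_le; apply/andP; split; nra.
have [phi dphi] := open_subgradient cf fN oI fin Ix.
apply/seteqP; split=> psi /=; first exact: sub.
by move=> ->; rewrite -(sub _ dphi).
Qed.

Lemma subdifferential_differentiable (R : realType) (f : R -> \bar R) (I : set R) :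
  convex_efun f -> (forall u, f u != -oo%E) -> open I -> differentiable_on I f ->
  forall x, I x -> subdifferential f x = [set (fine \o f)^`()%classic x].
Proof.
move=> cf fN oI dfI x Ix.
have fin y : I y -> f y \is a fin_num by move=> /dfI[].
have sub phi : subdifferential f x phi -> phi = (fine \o f)^`()%classic x.
  move=> dphi; have [d d0 hd] := open_ballP oI Ix.
  apply: (subgradient_eq_derive1 (dfI _ Ix).2 d0) => h hh.
  have Ih : I (x + h) by apply: hd; rewrite addrAC subrr add0r.
  have := subdifferential_fine dphi (fin _ Ih) => /=.
  by rewrite [x + h - x]addrAC subrr add0r; lra.
have [phi dphi] := open_subgradient cf fN oI fin Ix.
apply/seteqP; split=> psi /=; first exact: sub.
by move=> ->; rewrite -(sub _ dphi).
Qed.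

(** A subgradient common to two points would bound f at their midpoint below by the average of the
    two values, against strict convexity. *)
Lemma strictly_convex_strictly_monotone (R : realType) (f : R -> \bar R) (I : set R) :
  (forall x y z, I x -> I y -> x <= z -> z <= y -> I z) ->
  (forall x, I x -> f x \is a fin_num) -> strictly_convex_on I f ->
  strictly_monotone_op (restrict_op I (subdifferential f)).
Proof.
move=> cI fin scf.
have mono : monotone_op (restrict_op I (subdifferential f)).
  by move=> x y p q [_ dp] [_ dq]; exact: subdifferential_monotone dp dq.
split=> // x y p q Rx Ry xy; have [[Ix dp] [Iy dq]] := (Rx, Ry).
rewrite lt_neqAle mono// andbT eq_sym mulf_neq0// ?subr_eq0//.
apply/eqP => pq; move: dq; rewrite -pq => dq.
pose m := 2^-1 * x + (1 - 2^-1) * y.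
have Im : I m.
  by case: (ltgtP x y) xy => // xy _; [apply: (cI x y)|apply: (cI y x)] => //;
    rewrite /m; lra.
have := subdifferential_fine dp (fin _ Im).
have := subdifferential_fine dq (fin _ Im).
have := scf x y 2^-1 Ix Iy xy _; rewrite -/m.
have [[c fx] [[d fy] [e fm]]] :=
  (fin_numEx (fin _ Ix), (fin_numEx (fin _ Iy), fin_numEx (fin _ Im))).
rewrite fx fy fm -!EFinM -EFinD lte_fin /= /m => h h1 h2.
by have := h _; rewrite ltNge => /(_ _)/negP; apply; lra.
Qed.

Lemma class_T_subdifferential (R : realType) (f : R -> \bar R) :
  class_F f -> proper_function f -> class_T (subdifferential f).
Proof.
move=> [A [brA [fN [clf cf] _ hA]]] pf.
(* Being maximal, the subdifferential is its own maximal monotone extension. *)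
exists A; split=> //; exists (subdifferential f).
  by split=> //; exact: subdifferential_maximal.
move=> i iA; have oI := @gap_open R A i.
case: (hA i iA) => [[a [b fab]]|[scf dfI]|fy].
- by apply: Or31; exists a; exact: subdifferential_affine fab.
- have dfE := subdifferential_differentiable cf fN oI dfI.
  have fin y : gap A i y -> f y \is a fin_num by move=> /dfI[].
  apply: Or32; split.
    exists (fine \o f)^`()%classic => //.
    apply: continuous_in_subspaceT.
    apply: (@subgradient_continuous _ _ (fine \o f)) => //.
      move=> x y /set_mem Ix /set_mem Iy; apply: subdifferential_fine (fin _ Iy).
      by rewrite dfE.
    by move=> x /set_mem /dfI[].
  by apply: strictly_convex_strictly_monotone => //; exact: gap_between.
- by apply: Or33 => x /fy fx; apply/seteqP; split=> // p [] /=; rewrite fx.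
Qed.

(** * Closedness, and continuity on the effective domain *)

Lemma lower_semicontinuous_closed (R : realType) (f : R -> \bar R) :
  lower_semicontinuous f -> closed_function f.
Proof.
move=> lf; rewrite /closed_function -[epigraph f]setCK; apply: open_closedC.
rewrite openE => -[x r]; rewrite /epigraph /= => /negP; rewrite -ltNge => rfx.
(* A level a strictly between r and [f x] yields a product neighborhood of (x, r) that misses the
   epigraph. *)
have [a ra afx] : exists2 a, r < a & (a%:E < f x)%E.
  case: (f x) rfx => [v| |]//=; last by exists (r + 1); [lra|exact: ltry].
  by rewrite lte_fin => rv; exists ((r + v) / 2); rewrite ?lte_fin; lra.
have [V nV hV] := lf x a afx.
exists (V, [set s | s < a]) => /=.
  by split=> //=; exact: lt_nbhsl.
move=> [y s] [/= Vy sa]; apply/negP; rewrite -ltNge.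
by apply: lt_trans (hV _ Vy); rewrite lte_fin.
Qed.

(** Semicontinuity gives the lower estimate. On a side of x that contains another domain point y,
    the chord from x to y gives the upper one; on a side without domain points there is nothing to
    estimate. *)
Lemma convex_effective_domain_continuous (R : realType) (f : R -> \bar R) :
  lower_semicontinuous f -> convex_efun f -> (forall u, f u != -oo%E) ->
  {within effective_domain f, continuous f}.
Proof.
move=> lf cf fN; apply/subspace_continuousP => x Dx.
have [c fx] := fin_numEx Dx.
change (f z @[z --> within (effective_domain f) (nbhs x)] --> f x); rewrite fx.
apply/fine_cvgP; split.
  exact: withinT.
apply/cvgrPdist_le => e e0.
have lower : \forall z \near x, ((c - e)%:E < f z)%E.
  have [|V nV hV] := lf x (c - e); first by rewrite fx lte_fin; lra.
  by apply: filterS nV.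
have upper (y : R) : y != x -> f y \is a fin_num ->
    \forall z \near x, 0 < (z - x) * (y - x) -> (f z <= (c + e)%:E)%E.
  move=> yx /fin_numEx[v fy].
  have D0 : 0 < `|v - c| + 1 by rewrite ltr_wpDl.
  (* For z = t y + (1 - t) x this radius forces t < 1 and t (|v - c| + 1) < e, so the chord value c
     + t (v - c) is at most c + e. The added 1 keeps the denominator positive. *)
  pose d := Num.min 1 (e / (`|v - c| + 1)) * `|y - x|.
  have yx0 : 0 < `|y - x| by rewrite normr_gt0 subr_eq0.
  have d0 : 0 < d by rewrite mulr_gt0// lt_min ltr01 divr_gt0.
  apply/nbhs_ballP; exists d => // z; rewrite /ball /= => xz zxy.
  pose t := (z - x) / (y - x).
  have yx1 : y - x != 0 by rewrite subr_eq0.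
  have tE : t * (y - x) = z - x by rewrite /t; field.
  have t0 : 0 < t.
    rewrite -tE -mulrA in zxy.
    by rewrite -(pmulr_lgt0 _ (_ : 0 < (y - x) * (y - x)))// -expr2 exprn_even_gt0.
  have : t < Num.min 1 (e / (`|v - c| + 1)).
    rewrite -(ltr_pM2r yx0) -/d; apply: le_lt_trans xz.
    by rewrite [`|x - z|]distrC -tE normrM gtr0_norm.
  rewrite lt_min => /andP[t1]; rewrite ltr_pdivlMr// => te.
  have fx' : (f x <= c%:E)%E by rewrite fx.
  have fy' : (f y <= v%:E)%E by rewrite fy.
  have := convex_efun_le cf (ltW t0) (ltW t1) fy' fx'.
  have -> : t * y + (1 - t) * x = z by move: tE; lra.
  move=> h; apply: le_trans h _; rewrite lee_fin.
  by have := ler_norm (v - c); nra.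
(* The sign of s selects the side of x. *)
have side (s : R) : \forall z \near x, 0 < (z - x) * s -> f z \is a fin_num ->
    (f z <= (c + e)%:E)%E.
  have [[y [ys fy]]|no] := pselect (exists y, 0 < (y - x) * s /\ f y \is a fin_num).
    have yx : y != x by apply: contraTneq ys => ->; rewrite subrr mul0r ltxx.
    apply: filterS (upper y yx fy) => z hz zs _; apply: hz.
    have : 0 < ((z - x) * s) * ((y - x) * s) by rewrite mulr_gt0.
    have s2 : 0 < s * s.
      by rewrite -expr2 exprn_even_gt0//=; apply: contraTneq ys => ->; rewrite mulr0 ltxx.
    by rewrite mulrACA pmulr_lgt0.
  by apply: (@filterS _ (nbhs x) _ setT) filterT => z _ zs fz; case: no; exists z.
have right := side 1; have left := side (-1).
rewrite near_withinE; near=> z => Dz.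
have [v fz] := fin_numEx Dz; rewrite /= fz /=.
have lz : ((c - e)%:E < f z)%E by near: z.
have rz : 0 < (z - x) * 1 -> f z \is a fin_num -> (f z <= (c + e)%:E)%E by near: z.
have lz' : 0 < (z - x) * -1 -> f z \is a fin_num -> (f z <= (c + e)%:E)%E by near: z.
rewrite fz /= !lee_fin in rz lz'; rewrite fz lte_fin in lz.
have vc : v <= c + e.
  case: (ltgtP z x) => zx; [by apply: lz' => //; lra|by apply: rz => //; lra|].
  by move: fz; rewrite zx fx => -[<-]; lra.
by rewrite ler_norml; apply/andP; split; lra.
Unshelve. all: by end_near. Qed.

(** * From the pieces of the subdifferential back to the pieces of the function *)

(** This transfers the piecewise description in [class_T], stated for some extension, to a maximal
    [T] itself. *)
Lemma maximal_monotone_extension_eq (R : realType) (T S : R -> set R) :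
  maximal_monotone T -> maximal_monotone_extension T S -> S = T.
Proof.
move=> [_ maxT] [[monoS _] TS].
have ST : graph_of S `<=` graph_of T.
  by apply: contrapT => nST; apply: maxT; exists S.
by apply/funext => x; apply/seteqP; split=> y h; [exact: (ST (x, y))|exact: (TS (x, y))].
Qed.

(** When two points share a subgradient, their two subgradient inequalities are opposite and combine
    into an equality. *)
Lemma constant_subdifferential_affine (R : realType) (f : R -> \bar R)
    (I : set R) (c : R) :
  (forall x, I x -> subdifferential f x c) -> affine_on I f.
Proof.
move=> dfc; have [[x0 Ix0]|I0] := pselect (I !=set0); last first.
  by exists 0, 0 => x Ix; case: I0; exists x.
exists c, (fine (f x0) - c * x0) => x Ix.
have [fx _] := dfc _ Ix; have [fx0 _] := dfc _ Ix0.
have := subdifferential_fine (dfc _ Ix) fx0.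
have := subdifferential_fine (dfc _ Ix0) fx.
move=> h1 h2; rewrite -[LHS]fineK//.
by congr EFin; lra.
Qed.

Lemma strictly_monotone_strictly_convex (R : realType) (f : R -> \bar R) (I : set R)
    (g : R -> R) :
  (forall x y z, I x -> I y -> x <= z -> z <= y -> I z) ->
  (forall x, I x -> subdifferential f x = [set g x]) ->
  strictly_monotone_op (restrict_op I (subdifferential f)) ->
  strictly_convex_on I f.
Proof.
move=> cI dfg [_ smono].
have dg x : I x -> subdifferential f x (g x) by move=> /dfg ->.
have fin x : I x -> f x \is a fin_num by move=> /dg[].
(* Passing through the midpoint w of z and x makes the tangent inequality strict: the second half of
   the way uses [g w], and strict monotonicity separates it from [g z]. *)
have above z x : I z -> I x -> x != z ->
    fine (f z) + g z * (x - z) < fine (f x).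
  move=> Iz Ix xz; pose w := (x + z) / 2.
  have Iw : I w.
    by have [zx|xz'] := leP z x; [apply: (cI z x)|apply: (cI x z)] => //;
      rewrite /w; lra.
  have wz : w != z by rewrite -subr_eq0 /w; apply: contra xz => /eqP ?; apply/eqP; lra.
  have := smono w z (g w) (g z) (conj Iw (dg _ Iw)) (conj Iz (dg _ Iz)) wz.
  have := subdifferential_fine (dg _ Iw) (fin _ Ix).
  have := subdifferential_fine (dg _ Iz) (fin _ Iw).
  have -> : x = 2 * w - z by rewrite /w; lra.
  by nra.
move=> x y t Ix Iy xy /andP[t0 t1]; set z := t * x + (1 - t) * y.
have Iz : I z.
  by case: (ltgtP x y) xy => // xy _; [apply: (cI x y)|apply: (cI y x)] => //;
    rewrite /z; nra.
have xz : x != z.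
  rewrite -subr_eq0 (_ : x - z = (1 - t) * (x - y)); last by rewrite /z; ring.
  by rewrite mulf_neq0// subr_eq0// gt_eqF.
have yz : y != z.
  rewrite -subr_eq0 (_ : y - z = t * (y - x)); last by rewrite /z; ring.
  by rewrite mulf_neq0// ?subr_eq0 1?eq_sym// lt_eqF.
have := above _ _ Iz Ix xz; have := above _ _ Iz Iy yz.
have [[c fx] [[d fy] [e fz]]] :=
  (fin_numEx (fin _ Ix), (fin_numEx (fin _ Iy), fin_numEx (fin _ Iz))).
rewrite fx fy fz -!EFinM -EFinD lte_fin /= => hy hx.
have hx' : t * (e + g z * (x - z)) < t * c by rewrite ltr_pM2l.
have hy' : (1 - t) * (e + g z * (y - z)) < (1 - t) * d by rewrite ltr_pM2l// subr_gt0.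
apply: le_lt_trans (ltrD hx' hy').
by rewrite le_eqVlt; apply/orP; left; apply/eqP; rewrite /z; ring.
Qed.

(** If f were finite at x, a second domain point y would make points of [I] strictly between x and y
    interior to the domain, where subgradients exist; without such a y, every number is a
    subgradient at x. *)
Lemma empty_subdifferential_infinite (R : realType) (f : R -> \bar R) (I : set R) :
  convex_efun f -> (forall u, f u != -oo%E) -> open I ->
  (forall x, I x -> subdifferential f x = set0) -> forall x, I x -> f x = +oo%E.
Proof.
move=> cf fN oI df0 x Ix.
have no z phi : I z -> ~ subdifferential f z phi by move=> /df0 ->.
case fx : (f x) (fN x) => [c| |]// _.
have fx' : (f x <= c%:E)%E by rewrite fx.
have [[y yx /fin_numEx[v fy]]|h] := two_points_or_singleton x fN; last first.
  by case: (no x 0 Ix); exact: singleton_domain_subgradient fx h.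
have fy' : (f y <= v%:E)%E by rewrite fy.
have [d d0 hd] := open_ballP oI Ix.
have yx0 : 0 < `|y - x| by rewrite normr_gt0 subr_eq0.
(* This step from x towards y stays in [I] and stops short of y. *)
pose e := Num.min d `|y - x| / 2.
have m0 : 0 < Num.min d `|y - x| by rewrite lt_min d0.
have e0 : 0 < e by rewrite divr_gt0.
have : e < Num.min d `|y - x| by rewrite /e; lra.
rewrite lt_min => /andP[ed exy].
case: (ltgtP x y) => [xy|xy|xy]; last by rewrite xy eqxx in yx.
- rewrite gtr0_norm ?subr_gt0// in exy.
  have Ie : I (x + e) by apply: hd; rewrite addrAC subrr add0r gtr0_norm.
  have [||phi dphi] := interior_subgradient (z := x + e) cf fN _ _ fx' fy'; [lra|lra|].
  by case: (no _ _ Ie dphi).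
- rewrite ltr0_norm ?subr_lt0// in exy.
  have Ie : I (x - e) by apply: hd; rewrite addrAC subrr add0r normrN gtr0_norm.
  have [||phi dphi] := interior_subgradient (z := x - e) cf fN _ _ fy' fx'; [lra|lra|].
  by case: (no _ _ Ie dphi).
Qed.

Lemma class_F_of_subdifferential (R : realType) (f : R -> \bar R) :
  proper_function f -> lower_semicontinuous f -> convex_efun f ->
  maximal_monotone (subdifferential f) -> class_T (subdifferential f) -> class_F f.
Proof.
move=> pf lf cf maxf [B [brB [S extS hB]]].
move: hB; rewrite (maximal_monotone_extension_eq maxf extS) => hB.
have fN := pf.2.
exists B; split=> //; split=> //.
- by split=> //; exact: lower_semicontinuous_closed.
- exact: convex_effective_domain_continuous.
move=> i iB; have oI := @gap_open R B i.
case: (hB i iB) => [[c dfc]|[[g dfg cg] smono]|df0].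
- apply: Or31; apply: (@constant_subdifferential_affine _ _ _ c) => x Ix.
  by rewrite dfc.
- have dg x : gap B i x -> subdifferential f x (g x) by move=> /dfg ->.
  have fin x : gap B i x -> f x \is a fin_num by move=> /dg[].
  apply: Or32; split.
    by apply: strictly_monotone_strictly_convex dfg smono; exact: gap_between.
  move=> x Ix; split; first exact: fin.
  apply: (@continuous_subgradient_derivable _ (gap B i) _ g) => //; last exact: mem_set.
  move=> y z /set_mem Iy /set_mem Iz.
  exact: subdifferential_fine (dg _ Iy) (fin _ Iz).
- by apply: Or33; exact: empty_subdifferential_infinite.
Qed.

(** * Integration of monotone operators *)

Definition graph_le (R : realType) (p q : R * R) : bool := (p.1 <= q.1) && (p.2 <= q.2).

Lemma graph_le_total (R : realType) (T : R -> set R) (p q : R * R) :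
  monotone_op T -> T p.1 p.2 -> T q.1 q.2 -> graph_le p q || graph_le q p.
Proof.
move: p q => [x p] [y q] mono /= Tp Tq; rewrite /graph_le /=.
have := mono _ _ _ _ Tp Tq.
case: (ltgtP x y) => [xy|xy|<-] /=.
- by rewrite nmulr_rge0 ?subr_lt0// subr_le0 => ->.
- by rewrite pmulr_rge0 ?subr_gt0// subr_ge0 => ->.
- by move=> _; exact: le_total.
Qed.

Lemma finite_graph_potential (R : realType) (T : R -> set R) (s : seq (R * R)) :
  monotone_op T -> (forall q, q \in s -> T q.1 q.2) ->
  exists F : R -> R, forall q y, q \in s -> F q.1 + q.2 * (y - q.1) <= F y.
Proof.
move=> mono sT.
(* The reversed order puts the largest point at the head, where list induction adds it last. *)
pose geg := fun p q : R * R => graph_le q p.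
have geg_trans : transitive geg.
  move=> q p r /andP[qp1 qp2] /andP[rq1 rq2].
  by rewrite /geg /graph_le (le_trans rq1 qp1) (le_trans rq2 qp2).
have : sorted geg (sort geg s).
  apply: (@sort_sorted_in _ (mem s)); last by apply/allP.
  by move=> p q /sT Tp /sT Tq; exact: graph_le_total Tq Tp.
have memE := mem_sort geg s.
(* Induction on a decreasing list: adding a new largest point p adds a hinge
   at p.1 to F, which changes nothing to the left of p.1. *)
suff : forall u, sorted geg u -> exists F : R -> R,
    (forall q y, q \in u -> F q.1 + q.2 * (y - q.1) <= F y) /\
    (forall q, ohead u = Some q -> forall y, q.1 <= y -> F y = F q.1 + q.2 * (y - q.1)).
  by move=> h /h[F [hF _]]; exists F => q y qs; apply: hF; rewrite memE.
elim=> [|p u IH] /=; first by exists (fun=> 0).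
move=> pu; have [F [hF1 hF2]] := IH (path_sorted pu).
case: u pu hF1 hF2 {IH} => [|p' u] pu hF1 hF2.
  exists (fun y => p.2 * y); split.
    by move=> q y; rewrite inE => /eqP ->; lra.
  by move=> q [<-] y _; lra.
move: pu; rewrite path_sortedE// => /andP[/allP pu _].
pose F' y := F y + (p.2 - p'.2) * Num.max 0 (y - p.1).
have p'p : graph_le p' p by apply: pu; rewrite mem_head.
have p21 : 0 <= p.2 - p'.2 by case/andP: p'p; rewrite subr_ge0.
have Fp y : p'.1 <= y -> F y = F p'.1 + p'.2 * (y - p'.1) by exact: hF2.
have F'l y : y <= p.1 -> F' y = F y.
  by move=> yp; rewrite /F' max_l ?mulr0 ?addr0// subr_le0.
have F'g y : F y <= F' y.
  by rewrite /F' lerDl mulr_ge0// le_max lexx.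
(* Right of [p'.1] the slope of [F] is [p'.2]; the hinge raises it to [p.2] beyond [p.1], which
   restores the second invariant. *)
have F'r y : p.1 <= y -> F' y = F' p.1 + p.2 * (y - p.1).
  move=> py; rewrite (F'l p.1)//; rewrite /F' max_r ?subr_ge0//.
  case/andP: p'p => p'p1 _; rewrite (Fp y) ?(Fp p.1)//; first by lra.
  exact: le_trans p'p1 py.
exists F'; split; last by move=> q [<-] y; exact: F'r.
move=> q y; rewrite in_cons => /predU1P[->|qu]; last first.
  have /andP[qp _] := pu _ qu.
  by rewrite (F'l q.1)//; apply: le_trans (F'g y); exact: hF1.
have [py|yp] := leP p.1 y; first by rewrite (F'r y).
(* Left of [p.1] the new line lies below the line of slope [p'.2] through the same point, and that
   line is below [F] by the invariant for [p']. *)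
case/andP: p'p => p'p1 _.
rewrite (F'l p.1)// (Fp p.1)//; apply: le_trans (F'g y).
have := hF1 p' y (mem_head _ _); nra.
Qed.

(** * Rockafellar's function *)

(** The lower bound for f x - f p.1 obtained by applying subgradient inequalities successively along
    p, the points of s, and x. *)
Fixpoint chain_sum (R : realType) (p : R * R) (s : seq (R * R)) (x : R) : R :=
  if s is q :: s' then p.2 * (q.1 - p.1) + chain_sum q s' x else p.2 * (x - p.1).

Lemma chain_sum_rcons (R : realType) (p q : R * R) (s : seq (R * R)) (x : R) :
  chain_sum p (rcons s q) x = chain_sum p s q.1 + q.2 * (x - q.1).
Proof. by elim: s p => [|r s IH] p //=; rewrite IH addrA. Qed.

Lemma chain_sum_convex (R : realType) (p : R * R) (s : seq (R * R)) (x y t : R) :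
  chain_sum p s (t * x + (1 - t) * y) =
  t * chain_sum p s x + (1 - t) * chain_sum p s y.
Proof. by elim: s p => [|r s IH] p /=; rewrite ?IH; ring. Qed.

Lemma chain_sum_continuous (R : realType) (p : R * R) (s : seq (R * R)) :
  continuous (chain_sum p s).
Proof.
elim: s p => [|r s IH] p x /=.
  by apply: cvgM; [exact: cvg_cst|apply: cvgB; [exact: cvg_id|exact: cvg_cst]].
by apply: cvgD; [exact: cvg_cst|exact: IH].
Qed.

(** This is cyclic monotonicity. With a common potential F for the points of the chain, the sum up
    to x telescopes to at most F x - F p.1, which vanishes when the chain closes. *)
Lemma chain_sum_cyclic (R : realType) (T : R -> set R) (p : R * R) (s : seq (R * R)) :
  monotone_op T -> (forall q, q \in p :: s -> T q.1 q.2) -> chain_sum p s p.1 <= 0.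
Proof.
move=> mono hT; have [F hF] := finite_graph_potential mono hT.
suff h x : chain_sum p s x <= F x - F p.1 by rewrite -(subrr (F p.1)).
elim: s p hF {hT} => [|q s IH] p hF /=.
  by have := hF p x (mem_head _ _); lra.
have := hF p q.1 (mem_head _ _).
have := IH q (fun r y rs => hF r y (mem_behead (s := p :: q :: s) rs)).
by lra.
Qed.

(** For p in the graph, any function that vanishes at [p.1] and has the points of the graph as
    subgradients dominates all these chain sums, hence their supremum. *)
Definition rockafellar (R : realType) (T : R -> set R) (p : R * R) (x : R) : \bar R :=
  ereal_sup [set (chain_sum p s x)%:E |
    s in [set s : seq (R * R) | forall q, q \in s -> T q.1 q.2]].

Lemma rockafellar_leP (R : realType) (T : R -> set R) (p : R * R) (x r : R) :
  (rockafellar T p x <= r%:E)%E <->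
  forall s, (forall q, q \in s -> T q.1 q.2) -> chain_sum p s x <= r.
Proof.
split=> [h s sT|h].
  by rewrite -lee_fin; apply: le_trans h; apply: ereal_sup_ubound; exists s.
by apply: ge_ereal_sup => _ [s sT <-]; rewrite lee_fin; exact: h.
Qed.

Lemma rockafellar_neqNy (R : realType) (T : R -> set R) (p : R * R) (x : R) :
  rockafellar T p x != -oo%E.
Proof.
rewrite -ltNye; apply: (@lt_le_trans _ _ (chain_sum p [::] x)%:E).
  exact: ltNyr.
by apply: ereal_sup_ubound; exists [::].
Qed.

Lemma rockafellar_lower_semicontinuous (R : realType) (T : R -> set R) (p : R * R) :
  lower_semicontinuous (rockafellar T p).
Proof.
move=> x a /ereal_sup_gt[_ [s sT <-]]; rewrite lte_fin => as_.
exists [set y | a < chain_sum p s y].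
  exact: (cvgr_gt _ (@chain_sum_continuous R p s x)).
move=> y ay; apply: lt_le_trans (_ : ((chain_sum p s y)%:E <= _)%E).
  by rewrite lte_fin.
by apply: ereal_sup_ubound; exists s.
Qed.

Lemma rockafellar_convex (R : realType) (T : R -> set R) (p : R * R) :
  convex_efun (rockafellar T p).
Proof.
move=> [x r] [y s] t; rewrite !inE /epigraph /=.
move=> /rockafellar_leP hx /rockafellar_leP hy; apply/rockafellar_leP => u uT.
have /= -> := chain_sum_convex p u x y t%:num.
by apply: lerD; apply: ler_wpM2l; rewrite ?subr_ge0// ?hx ?hy.
Qed.

(** Appending (x, phi) to a chain ending at x turns it into a chain ending at y and adds phi (y -
    x); the supremum over chains gives the subgradient inequality. *)
Lemma rockafellar_subgradient (R : realType) (T : R -> set R) (p : R * R) (x phi : R) :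
  monotone_op T -> T p.1 p.2 -> T x phi ->
  subdifferential (rockafellar T p) x phi.
Proof.
move=> mono Tp Tx.
have rconsT s : (forall q, q \in s -> T q.1 q.2) ->
    forall q, q \in rcons s (x, phi) -> T q.1 q.2.
  by move=> sT q; rewrite mem_rcons inE => /predU1P[->//|]; exact: sT.
have [c fx] : exists c, rockafellar T p x = c%:E.
  (* The bound comes from closing each chain through (x, phi) back to [p.1]. *)
  apply: (@fin_num_le_EFin _ _ (- (phi * (p.1 - x)))).
    exact: rockafellar_neqNy.
  apply/rockafellar_leP => s sT.
  have : chain_sum p (rcons s (x, phi)) p.1 <= 0.
    by apply: (chain_sum_cyclic mono) => q; rewrite inE => /predU1P[->//|]; exact: rconsT.
  by rewrite chain_sum_rcons /=; lra.
apply/(subdifferentialP _ fx) => y r /rockafellar_leP hr.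
rewrite -lerBrDr -lee_fin -fx; apply/rockafellar_leP => s sT.
by have := hr _ (rconsT _ sT); rewrite chain_sum_rcons /=; lra.
Qed.

(** The subdifferential of Rockafellar's function is monotone and contains T, so maximality forces
    equality. *)
Lemma maximal_monotone_subdifferential (R : realType) (T : R -> set R) :
  maximal_monotone T -> exists f : R -> \bar R,
    [/\ proper_function f, lower_semicontinuous f, convex_efun f &
        T = subdifferential f].
Proof.
move=> [mono maxT].
have [p Tp] : exists p : R * R, T p.1 p.2.
  (* An empty graph is not maximal: the single point (0, 0) extends it. *)
  apply: contrapT => noT; apply: maxT; exists (fun x => [set y | x = 0 /\ y = 0]).
  split.
    by move=> x y p q [-> ->] [-> ->]; rewrite subrr mul0r.
  split=> [q Tq|sub]; first by case: noT; exists q.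
  by apply: noT; exists (0, 0); exact: (sub (0, 0)).
have sub x phi := @rockafellar_subgradient R T p x phi mono Tp.
exists (rockafellar T p); split.
- by split; [exists p.1; exact: (sub _ _ Tp).1|exact: rockafellar_neqNy].
- exact: rockafellar_lower_semicontinuous.
- exact: rockafellar_convex.
apply/funext => x; apply/seteqP; split=> phi; first exact: sub.
move=> dphi; apply: contrapT => nT; apply: maxT.
exists (subdifferential (rockafellar T p)).
split; first exact: subdifferential_monotone.
by split=> [q|/(_ (x, phi) dphi)//]; exact: sub.
Qed.

Theorem theorem3p1 (R : realType) :
  (forall f : R -> \bar R, class_F f -> proper_function f ->
     maximal_monotone (subdifferential f) /\ class_T (subdifferential f)) /\
  (forall T : R -> set R, class_T T -> maximal_monotone T ->
     (exists f : R -> \bar R,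
        [/\ proper_function f, lower_semicontinuous f, convex_efun f &
            T = subdifferential f]) /\
     (forall f : R -> \bar R,
        proper_function f -> lower_semicontinuous f -> convex_efun f ->
        T = subdifferential f -> class_F f)).
Proof.
split=> [f Ff pf|T TT maxT].
  split; last exact: class_T_subdifferential.
  by have [A [_ [_ [clf cf] _ _]]] := Ff; exact: subdifferential_maximal.
split; first exact: maximal_monotone_subdifferential.
by move=> f pf lf cf Tf; apply: class_F_of_subdifferential => //; rewrite -Tf.
Qed.
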